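(* Let $G$ be a finite connected undirected graph and let $k(G)$ denote the minimum eccentricity of a shortest path of $G$. Let $r$ be an arbitrary vertex of $G$, let $x$ be a vertex maximizing $d(r,x)$, and let $y$ be a vertex maximizing $d(x,y)$. Then every shortest path between $x$ and $y$ has eccentricity at most $5\,k(G)$. Moreover, such a path (obtained by two successive breadth-first searches, from $r$ and then from $x$) can be computed in time $O(|V|+|E|)$. That is, this double-BFS procedure is a linear-time $5$-approximation algorithm for the Minimum Eccentricity Shortest Path problem.
   Context: $G=(V,E)$ is a finite connected undirected graph. The distance $d(u,v)$ is the number of edges of a shortest $u$–$v$ path; a shortest path is a path whose length equals the distance between its endpoints. For a vertex $v$ and a vertex set $S$, $d(v,S)=\min_{u\in S} d(v,u)$, and the eccentricity of $S$ is $ecc(S)=\max_{v\in V} d(v,S)$. The Minimum Eccentricity Shortest Path (MESP) problem asks for a shortest path $P$ of $G$ such that $ecc(P)\le ecc(Q)$ for every shortest path $Q$ of $G$; $k(G)$ is the eccentricity of such a path. An algorithm is an $\alpha$-approximation for MESP if every path it outputs is a shortest path of eccentricity at most $\alpha\, k(G)$. *)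

(* Defs.v *)
(* Library: Mathematical Components. *)
From mathcomp Require Import all_boot.
Set Implicit Arguments.
Unset Strict Implicit.
Unset Printing Implicit Defensive.

(** * Graphs, distances, eccentricities *)

Record sgraph := SGraph {
  vertex :> finType;
  adj : rel vertex;
  adj_sym : symmetric adj;
  adj_irr : irreflexive adj
}.

Definition edges (G : sgraph) : {set {set G}} :=
  [set [set u; v] | u in [set: G], v in [set w | adj u w]].

Definition connected (G : sgraph) := forall u v : G, connect (@adj G) u v.

Section Distances.
Variable G : sgraph.
Implicit Types (u v r x y : G) (S : {set G}) (P Q : seq G).

(* A path is the nonempty sequence of its (pairwise distinct) vertices. *)
Definition is_path P :=
  if P is u :: Q then path (@adj G) u Q && uniq P else false.

Definition path_between u v P :=
  [&& is_path P, head u P == u & last v P == v].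

Definition plength P := (size P).-1.

Definition has_path_of_length u v n :=
  [exists P : n.+1.-tuple G, path_between u v P].

(* A path has fewer than #|G| edges; the value is #|G| if no u-v path exists,
   which does not happen in a connected graph. *)
Definition dist u v := find (has_path_of_length u v) (iota 0 #|G|).

Definition shortest_path_between u v P :=
  path_between u v P && (plength P == dist u v).

Definition shortest_path P := [exists u, exists v, shortest_path_between u v P].

(* The default value #|G| of the minimum is larger than every distance in a
   connected graph, hence irrelevant when S is nonempty. *)
Definition dist_set v S := \big[minn/#|G|]_(u in S) dist v u.

Definition ecc S := \max_(v : G) dist_set v S.

Definition pecc P := ecc [set v in P].

Definition farthest r x := forall v, dist r v <= dist r x.

Definition is_mesp P :=
  shortest_path P /\ forall Q, shortest_path Q -> pecc P <= pecc Q.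

(* The minimum of pecc over all shortest paths, which have at most #|G|
   vertices; see mesp_exists and mesp_pecc below. *)
Definition mesp_ecc : nat :=
  \big[minn/#|G|]_(n < #|G|.+1)
    \big[minn/#|G|]_(P : n.-tuple G | shortest_path P) pecc P.

Lemma bigmin_le (I : finType) (p : pred I) (F : I -> nat) m i :
  p i -> \big[minn/m]_(j | p j) F j <= F i.
Proof.
move=> pi; have := mem_index_enum i.
elim: (index_enum I) => // j s IHs; rewrite inE big_cons => /predU1P [<-|/IHs le].
  by rewrite pi geq_minl.
by case: ifP => // _; rewrite geq_min le orbT.
Qed.

Lemma bigmin_attained (I : finType) (p : pred I) (F : I -> nat) m :
  \big[minn/m]_(j | p j) F j = m \/
  exists2 i, p i & \big[minn/m]_(j | p j) F j = F i.
Proof.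
elim/big_rec: _ => [|i z pi [-> | [j pj ->]]]; first by left.
- by rewrite /minn; case: ifP => _; [right; exists i | left].
- by rewrite /minn; case: ifP => _; right; [exists i | exists j].
Qed.

Lemma dist_lt u v : connected G -> dist u v < #|G|.
Proof.
move=> /(_ u v) /connectP [q qP ->]; case/shortenP: qP => q' q'P q'U _.
have szq : size q' < #|G|.
  by rewrite -[_.+1]/(size (u :: q')) -(card_uniqP q'U) max_card.
rewrite /dist -[X in _ < X](size_iota 0) -has_find; apply/hasP.
exists (size q'); first by rewrite mem_iota.
apply/existsP; exists (in_tuple (u :: q')).
by move: q'U; rewrite /path_between /= q'P !eqxx !andbT.
Qed.

Lemma dist_refl u : connected G -> dist u u = 0.
Proof.
move=> _; rewrite /dist; have: 0 < #|G| by apply/card_gt0P; exists u.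
case: #|G| => //= n _.
have -> // : has_path_of_length u u 0.
by apply/existsP; exists [tuple u]; rewrite /path_between /= eqxx.
Qed.

Lemma shortest_pathN0 P : shortest_path P -> exists u, u \in P.
Proof.
case/existsP=> u /existsP [v /andP [/and3P [+ _ _] _]].
by case: P => // a P _; exists a; rewrite mem_head.
Qed.

Lemma pecc_lt P : connected G -> shortest_path P -> pecc P < #|G|.
Proof.
move=> cG /shortest_pathN0 [u uP].
have G0 : 0 < #|G| by apply/card_gt0P; exists u.
rewrite -[X in _ < X]prednK // ltnS; apply/bigmax_leqP => v _.
rewrite -ltnS prednK //; apply: leq_ltn_trans (dist_lt v u cG).
by apply: bigmin_le; rewrite inE.
Qed.

Lemma mesp_ecc_le P : shortest_path P -> mesp_ecc <= pecc P.
Proof.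
move=> sP; have szP : size P < #|G|.+1.
  case/existsP: (sP) => u /existsP [v /andP [/and3P [+ _ _] _]].
  by case: P {sP} => // a P /andP [_ /card_uniqP <-]; rewrite ltnS max_card.
pose F (n : 'I_#|G|.+1) :=
  \big[minn/#|G|]_(P : n.-tuple G | shortest_path P) pecc P.
have H1 : mesp_ecc <= F (Ordinal szP) by apply: bigmin_le.
apply: leq_trans H1 _.
exact: (@bigmin_le _ (fun Q : (size P).-tuple G => shortest_path Q)
          (fun Q : (size P).-tuple G => pecc Q) _ (in_tuple P)).
Qed.

Lemma mesp_exists r :
  connected G -> exists2 P, is_mesp P & pecc P = mesp_ecc.
Proof.
move=> cG.
have s1 : shortest_path [:: r].
  apply/existsP; exists r; apply/existsP; exists r.
  by rewrite /shortest_path_between /path_between /= dist_refl // eqxx.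
have lt : mesp_ecc < #|G|.
  exact: leq_ltn_trans (mesp_ecc_le s1) (pecc_lt cG s1).
suff [P sP eP] : exists2 P, shortest_path P & pecc P = mesp_ecc.
  by exists P => //; split=> // Q; rewrite eP; apply: mesp_ecc_le.
move: lt; rewrite /mesp_ecc.
set m := \big[minn/_]_(n < _) _ => ltm.
have [eqm | [n _ eqn]] : m = #|G| \/ exists2 n, _ & m = _ := bigmin_attained _ _ _.
  by rewrite eqm ltnn in ltm.
move: ltm; rewrite {}eqn => {m}; set m := \big[minn/_]_(P | _) _ => ltm.
have [eqm | [P sP eqP]] : m = #|G| \/ exists2 P, _ & m = _ := bigmin_attained _ _ _.
  by rewrite eqm ltnn in ltm.
by exists P.
Qed.

Lemma mesp_pecc P : connected G -> is_mesp P -> pecc P = mesp_ecc.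
Proof.
move=> cG [sP minP]; have [r _] := shortest_pathN0 sP.
have [Q [sQ _] eQ] := mesp_exists r cG.
by apply/eqP; rewrite eqn_leq mesp_ecc_le // andbT -eQ minP.
Qed.

End Distances.

(** * A unit-cost random access machine

    Programs are structured commands over registers and arrays of natural
    numbers, both indexed by nat.  Each assignment and each evaluation of a
    test costs one time unit.  The only arithmetic is successor, predecessor
    and comparison, so after t steps no value exceeds by more than t the
    largest one in the initial store and in the program text: the uniform cost measure
    cannot be abused through large numbers. *)

Inductive expr :=
| Const of nat
| Reg of nat
| Succ of nat        (* successor of the content of a register *)
| Pred of nat        (* predecessor of the content of a register; 0 if it is 0 *)
| Get of nat & nat.  (* Get a i: cell of array a indexed by register i *)

Inductive cmd :=
| Skip
| Set_ of nat & expr         (* Set_ i e: assign e to register i *)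
| Put of nat & nat & nat     (* Put a i j: assign register j to the cell of
                                array a indexed by register i *)
| Seq of cmd & cmd
| IfLt of nat & nat & cmd & cmd  (* tests compare two registers *)
| WhileLt of nat & nat & cmd.

Record store := Store { reg : nat -> nat; arr : nat -> nat -> nat }.

Definition eval (s : store) (e : expr) : nat :=
  match e with
  | Const c => c
  | Reg i => reg s i
  | Succ i => (reg s i).+1
  | Pred i => (reg s i).-1
  | Get a i => arr s a (reg s i)
  end.

Definition upd (A : Type) (f : nat -> A) i v := fun j => if j == i then v else f j.

Definition set_reg (s : store) i v := Store (upd (reg s) i v) (arr s).

Definition set_arr (s : store) a i v :=
  Store (reg s) (upd (arr s) a (upd (arr s a) i v)).

(* exec c s t s': started in s, the command c halts in s' after t steps. *)
Inductive exec : cmd -> store -> nat -> store -> Prop :=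
| ExecSkip s : exec Skip s 0 s
| ExecSet s i e : exec (Set_ i e) s 1 (set_reg s i (eval s e))
| ExecPut s a i j : exec (Put a i j) s 1 (set_arr s a (reg s i) (reg s j))
| ExecSeq c1 c2 s1 s2 s3 t1 t2 :
    exec c1 s1 t1 s2 -> exec c2 s2 t2 s3 -> exec (Seq c1 c2) s1 (t1 + t2) s3
| ExecIfT i j c1 c2 s t s' :
    reg s i < reg s j -> exec c1 s t s' -> exec (IfLt i j c1 c2) s t.+1 s'
| ExecIfF i j c1 c2 s t s' :
    reg s j <= reg s i -> exec c2 s t s' -> exec (IfLt i j c1 c2) s t.+1 s'
| ExecWhileT i j c s1 s2 s3 t1 t2 :
    reg s1 i < reg s1 j -> exec c s1 t1 s2 -> exec (WhileLt i j c) s2 t2 s3 ->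
    exec (WhileLt i j c) s1 (t1 + t2).+1 s3
| ExecWhileF i j c s :
    reg s j <= reg s i -> exec (WhileLt i j c) s 1 s.

Lemma exec_det c s t1 s1 t2 s2 :
  exec c s t1 s1 -> exec c s t2 s2 -> t1 = t2 /\ s1 = s2.
Proof.
move=> E; elim: E t2 s2 => {c s t1 s1} *;
  match goal with H : exec ?c _ _ ?s |- _ = _ /\ _ = ?s => inversion H end;
  subst;
  repeat match goal with
  | IH : forall t s, exec ?c ?s0 t s -> _, H : exec ?c ?s0 _ _ |- _ =>
      case: (IH _ _ H) => ? ?; subst; clear IH
  end; try done;
  match goal with
  | H1 : is_true (?m < ?n), H2 : is_true (?n <= ?m) |- _ =>
      by rewrite ltnNge H2 in H1
  end.
Qed.

(** * Graph algorithms on this machine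

    Registers 0 and 1 initially hold the number of vertices and a start vertex;
    arrays 0 and 1 hold the adjacency lists: the neighbours of vertex v are
    listed, in any order, in the cells of aADJ from aOFF[v] up to aOFF[v+1]
    (excluded).  All other registers and cells may contain anything.  The output
    is the vertex sequence aPATH[0], ..., aPATH[rLEN - 1].  Names of registers
    start with r, names of arrays with a. *)

Definition rN := 0.
Definition rR := 1.
Definition rLEN := 2.

Definition aOFF := 0.
Definition aADJ := 1.
Definition aPATH := 2.

(* num numbers the vertices by 0, ..., #|G| - 1; being injective, it is
   bijective. *)
Definition encodes (G : sgraph) (num : G -> 'I_#|G|) (r : G) (s : store) :=
  [/\ injective num,
      reg s rN = #|G|,
      reg s rR = num r,
      arr s aOFF 0 = 0
    & forall v : G,
        arr s aOFF (num v).+1 = arr s aOFF (num v) + #|[set w | adj v w]| /\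
        perm_eq [seq arr s aADJ j | j <- iota (arr s aOFF (num v))
                                             #|[set w | adj v w]|]
                [seq (num w : nat) | w <- enum [set w | adj v w]]].

Definition outputs (G : sgraph) (num : G -> 'I_#|G|) (s : store) (P : seq G) :=
  [seq arr s aPATH i | i <- iota 0 (reg s rLEN)] = [seq (num v : nat) | v <- P].

Definition runs_in_linear_time (p : cmd) :=
  exists C, forall (G : sgraph) num (r : G) s,
    connected G -> encodes num r s ->
    exists t s', exec p s t s' /\ t <= C * (#|G| + #|edges G|).

(* On every halting run on a connected graph G with start vertex r, the program
   outputs a vertex sequence P with spec G r P. *)
Definition always_outputs (p : cmd) (spec : forall G : sgraph, G -> seq G -> Prop) :=
  forall (G : sgraph) num (r : G) s t s',
    connected G -> encodes num r s -> exec p s t s' ->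
    exists2 P, outputs num s' P & spec G r P.

Definition mesp_approximation (a : nat) (p : cmd) :=
  always_outputs p (fun G _ P => shortest_path P /\ pecc P <= a * mesp_ecc G).

(** * The double breadth-first search *)

Declare Scope cmd_scope.
Delimit Scope cmd_scope with cmd.
Notation "i ::= e" := (Set_ i e) (at level 60, no associativity) : cmd_scope.
Notation "c1 ;; c2" := (Seq c1 c2) (at level 61, right associativity) : cmd_scope.

Definition rZERO := 3.
Definition rONE := 4.
Definition rX := 5.
Definition rY := 6.
Definition rHEAD := 7.
Definition rTAIL := 8.
Definition rU := 9.
Definition rW := 10.
Definition rI := 11.
Definition rSTOP := 12.
Definition rLU := 13.
Definition rLW := 14.

Definition aQUEUE := 3.
Definition aLEVEL := 4.
Definition aPARENT := 5.

Section Programs.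
Local Open Scope cmd_scope.

(* The level of a vertex is 0 before it is discovered, and one plus its distance
   from src afterwards.  At the end rU is the last vertex of the search order. *)
Definition bfs (src : nat) : cmd :=
  rI ::= Const 0 ;;
  WhileLt rI rN (
    Put aLEVEL rI rZERO ;;
    rI ::= Succ rI) ;;
  rHEAD ::= Const 0 ;;
  rTAIL ::= Const 1 ;;
  Put aQUEUE rHEAD src ;;
  Put aLEVEL src rONE ;;
  Put aPARENT src src ;;
  WhileLt rHEAD rTAIL (
    rU ::= Get aQUEUE rHEAD ;;
    rHEAD ::= Succ rHEAD ;;
    rLU ::= Get aLEVEL rU ;;
    rLU ::= Succ rLU ;;
    rI ::= Get aOFF rU ;;
    rSTOP ::= Succ rU ;;
    rSTOP ::= Get aOFF rSTOP ;;
    WhileLt rI rSTOP (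
      rW ::= Get aADJ rI ;;
      rLW ::= Get aLEVEL rW ;;
      IfLt rZERO rLW Skip (
        Put aLEVEL rW rLU ;;
        Put aPARENT rW rU ;;
        Put aQUEUE rTAIL rW ;;
        rTAIL ::= Succ rTAIL) ;;
      rI ::= Succ rI)).

(* Search from rR to find a farthest vertex rX, search from rX to find a farthest
   vertex rY, then follow the parents from rY back to rX. *)
Definition double_bfs : cmd :=
  rZERO ::= Const 0 ;;
  rONE ::= Const 1 ;;
  bfs rR ;;
  rX ::= Reg rU ;;
  bfs rX ;;
  rY ::= Reg rU ;;
  rLEN ::= Get aLEVEL rY ;;
  rI ::= Reg rLEN ;;
  rU ::= Reg rY ;;
  WhileLt rZERO rI (
    rI ::= Pred rI ;;
    Put aPATH rI rU ;;
    rU ::= Get aPARENT rU).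

End Programs.

(* Main.v *)
(** Let [p] be an optimal path, of eccentricity [k], and send every vertex [v] to
    the index [pi v] of a vertex of [p] at distance at most [k]; up to an error of
    [2 * k], distances are differences of indices, and only [k] when one of the
    two vertices lies on [p].  Assume [pi x <= pi y].  A shortest [x]-[y] path
    crosses every index between [pi x] and [pi y] at distance at most [2 * k], so
    it is within [3 * k] of any [v] projecting there.  If [v] projects beyond [y],
    comparing [y] not with [v] but with the projection of [v], which lies on [p],
    gives [pi v - pi y <= 3 * k] and [dist v y <= 5 * k].  If [v] projects before
    [x], the same argument applies to the search from [r] when [pi x < pi r];
    otherwise it bounds [pi y - pi x], and [x] alone has eccentricity [5 * k].

    The search keeps its queue sorted by distance from the source, with a
    processed prefix whose neighbours are all discovered: every vertex at most as
    far as the one being processed is then in the queue, so a newly discovered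
    vertex lies exactly one level further.  The cost of each iteration is charged
    to a vertex and to the entries of its adjacency list. *)

Require Import Defs.
From mathcomp Require Import all_boot.
From mathcomp Require Import zify.

Set Implicit Arguments.
Unset Strict Implicit.
Unset Printing Implicit Defensive.

(** * Eccentricity of the double sweep *)

Section Metric.
Variable G : sgraph.
Hypothesis cG : connected G.
Implicit Types (u v w : G) (s P Q : seq G).

(** The walk may repeat vertices; shortening it brings its length into the range below [#|G|] that
    [find] explores. *)
Lemma dist_path u s : path (@adj G) u s -> dist u (last u s) <= size s.
Proof.
move=> us; case/shortenP: (us) => s' us' Us' ss'.
have szs : size s' <= size s by apply: uniq_leq_size => //; case/andP: Us'.
apply: leq_trans szs.
have lt_s' : size s' < #|G|.
  by rewrite -[_.+1]/(size (u :: s')) -(card_uniqP Us') max_card.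
rewrite leqNgt; apply/negP => /(before_find 0).
rewrite nth_iota // add0n => /existsP []; exists (in_tuple (u :: s')).
by move: Us'; rewrite /path_between /= us' !eqxx !andbT.
Qed.

Lemma dist_attained u v :
  exists s, [/\ path (@adj G) u s, uniq (u :: s), last u s = v & size s = dist u v].
Proof.
have lt_d := dist_lt u v cG.
have /(nth_find 0) : has (has_path_of_length u v) (iota 0 #|G|).
  by rewrite has_find size_iota.
rewrite -/(dist u v) nth_iota // add0n => /existsP [[[|a s] //= sz]].
rewrite /path_between /= => /and3P [/andP [pa Ua] /eqP ea /eqP ev].
by move/eqP: sz => [sz]; subst a v; exists s.
Qed.

Lemma dist_sym u v : dist u v = dist v u.
Proof.
wlog suff: u v / dist u v <= dist v u.
  by move=> le; apply/eqP; rewrite eqn_leq !le.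
have [s [vs _ <- <-]] := dist_attained v u.
have : path (@adj G) (last v s) (rev (belast v s)).
  by rewrite rev_path (eq_path (e' := @adj G)) // => a b; rewrite adj_sym.
move/dist_path; rewrite size_rev size_belast.
by case: s {vs} => //= a s; rewrite rev_cons last_rcons.
Qed.

Lemma dist_triangle v u w : dist u w <= dist u v + dist v w.
Proof.
have [s [us _ <- <-]] := dist_attained u v.
have [s' [vs' _ <- <-]] := dist_attained (last u s) w.
by rewrite -last_cat -size_cat dist_path // cat_path us.
Qed.

Lemma dist_adj u v : adj u v -> dist u v <= 1.
Proof. by move=> uv; apply: (@dist_path u [:: v]); rewrite /= uv. Qed.

Lemma dist_eq0 u v : dist u v = 0 -> u = v.
Proof. by have [[|a s] [_ _ <- <-]] := dist_attained u v. Qed.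

Lemma dist_pred u v n : dist u v = n.+1 -> exists2 w, adj w v & dist u w = n.
Proof.
have [s [us _ sv sn]] := dist_attained u v; rewrite -sn.
case/lastP: s => [|s a] // in us sv sn *; rewrite size_rcons => -[<-].
move: us sv; rewrite rcons_path last_rcons => /andP [us sa] ea.
exists (last u s); rewrite -?ea //; apply/eqP; rewrite eqn_leq dist_path //=.
rewrite -ltnS -(size_rcons s a) sn -ea -addn1.
by apply: leq_trans (dist_triangle (last u s) u a) _; rewrite leq_add2l dist_adj.
Qed.

Lemma ecc_near P v : shortest_path P -> exists2 u, u \in P & dist v u <= pecc P.
Proof.
move=> sP; have [w wP] := shortest_pathN0 sP.
have le : dist_set v [set u in P] <= pecc P by apply: leq_bigmax.
(* The default [#|G|] exceeds every distance, so the minimum is attained at a vertex of [P]. *)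
have [eqG | [u uP equ]] := bigmin_attained (fun u => u \in [set u in P]) (dist v) #|G|.
  have := dist_lt v w cG; rewrite ltnNge -{1}eqG => /negP [].
  by apply: bigmin_le; rewrite inE.
by exists u; [rewrite inE in uP | rewrite -equ].
Qed.

Lemma pecc_leP P n :
  (forall v, exists2 u, u \in P & dist v u <= n) -> pecc P <= n.
Proof.
move=> near; apply/bigmax_leqP => v _; have [u uP] := near v.
by apply: leq_trans; apply: bigmin_le; rewrite inE.
Qed.

Lemma shortest_path_betweenP u v P : shortest_path_between u v P ->
  exists s, [/\ P = u :: s, path (@adj G) u s, last u s = v & size s = dist u v].
Proof.
case: P => [|a s]; rewrite /shortest_path_between /path_between //=.
by case/andP=> /and3P [/andP [us _] /eqP <- /eqP us'] /eqP; exists s.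
Qed.

Lemma dist_nth_le a u s i j : path (@adj G) u s -> i <= j <= size s ->
  dist (nth a (u :: s) i) (nth a (u :: s) j) <= j - i.
Proof.
move=> us; elim: j => [|j IHj] /andP [].
  by rewrite leqn0 => /eqP -> _; rewrite dist_refl.
rewrite leq_eqVlt => /predU1P [-> _|lt_ij lt_js]; first by rewrite dist_refl // subnn.
have le_ij : i <= j <= size s by lia.
have dj := dist_adj (pathP a us j lt_js).
have := dist_triangle (nth a (u :: s) j) (nth a (u :: s) i) (nth a s j).
have := IHj le_ij; rewrite -[nth a (u :: s) j.+1]/(nth a s j); lia.
Qed.

(** A shortcut between two vertices of a shortest path would bring its ends closer together than its
    length. *)
Lemma dist_nth a u s i j : path (@adj G) u s -> size s = dist u (last u s) ->
  i <= j <= size s -> dist (nth a (u :: s) i) (nth a (u :: s) j) = j - i.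
Proof.
move=> us sz ij; set p := nth a (u :: s).
have le k l : k <= l <= size s -> dist (p k) (p l) <= l - k by apply: dist_nth_le.
have p0 : p 0 = u by [].
have pl : p (size s) = last u s by rewrite /p (last_nth a).
rewrite -p0 -pl in sz.
have := dist_triangle (p i) (p 0) (p (size s)).
have := dist_triangle (p j) (p i) (p (size s)).
have := le 0 i; have := le i j ij; have := le j (size s); lia.
Qed.

(* [pi v] is the index on the path [p] of a vertex at distance at most [k] from
   [v]. *)
Lemma crossing p L k (pi : G -> nat) x s m :
  (forall i j, i <= j <= L -> dist (p i) (p j) = j - i) ->
  (forall v, pi v <= L) -> (forall v, dist v (p (pi v)) <= k) ->
  path (@adj G) x s -> pi x <= m <= pi (last x s) ->
  exists2 q, q \in x :: s & dist (p m) q <= 2 * k.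
Proof.
move=> pP piL pik; elim: s x => [|a s IHs] x /=.
  move=> _ mx; exists x; first exact: mem_head.
  by have -> : m = pi x; [lia | rewrite dist_sym (leq_trans (pik x)) //; lia].
case/andP=> xa /IHs {}IHs /andP [le_xm le_ms].
have [le_am | lt_ma] := leqP (pi a) m.
  by have [|q qs le] := IHs; [lia | exists q => //; rewrite inE qs orbT].
have d1 := dist_adj xa; have dx := pik x; have da := pik a; have La := piL a.
(* One edge moves the projection by at most [2 * k + 1] indices, so [m], caught between two
   consecutive projections, is within [k] of one of them; another [k] leads from there to [x] or
   [a]. *)
have dxa : dist (p (pi x)) (p (pi a)) <= 2 * k + 1.
  have := dist_triangle x (p (pi x)) (p (pi a)); have := dist_triangle a x (p (pi a)).
  by rewrite (dist_sym _ x); lia.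
rewrite pP in dxa; last by lia.
have [near | far] := leqP (m - pi x) k.
  exists x; first exact: mem_head.
  have := dist_triangle (p (pi x)) (p m) x.
  by rewrite (dist_sym _ x) (dist_sym (p m)) pP ?(dist_sym _ x); lia.
exists a; first by rewrite inE mem_head orbT.
by have := dist_triangle (p (pi a)) (p m) a; rewrite pP ?(dist_sym _ a); lia.
Qed.

(** * Comparing projections onto an optimal path *)

Section Approximation.
Variables (k L : nat) (r x y : G) (s : seq G).
Hypotheses (far_x : farthest r x) (far_y : farthest x y).
Hypotheses (xs : path (@adj G) x s) (xsy : last x s = y).

Lemma double_sweep_near p (pi : G -> nat) v :
  (forall i j, i <= j <= L -> dist (p i) (p j) = j - i) ->
  (forall v, pi v <= L) -> (forall v, dist v (p (pi v)) <= k) ->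
  pi x <= pi y -> exists2 q, q \in x :: s & dist v q <= 5 * k.
Proof.
move=> pP piL pik le_xy.
have xin : x \in x :: s by apply: mem_head.
have yin : y \in x :: s by rewrite -xsy mem_last.
have pS i j : i <= L -> j <= L -> dist (p i) (p j) = (j - i) + (i - j).
  move=> iL jL; have [le|/ltnW le] := leqP i j.
    by rewrite pP ?le //; lia.
  by rewrite dist_sym pP ?le //; lia.
have up u w : dist u w <= (pi w - pi u) + (pi u - pi w) + 2 * k.
  have := dist_triangle (p (pi u)) u w; have := dist_triangle (p (pi w)) (p (pi u)) w.
  by rewrite pS // (dist_sym (p (pi w)) w); have := pik u; have := pik w; lia.
have down u i : i <= L -> (i - pi u) + (pi u - i) <= dist u (p i) + k.
  move=> iL; have := dist_triangle u (p (pi u)) (p i).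
  by rewrite pS // (dist_sym (p (pi u)) u); have := pik u; lia.
(* Maximality of [x], tested at the projection of [y], gives [pi y - pi x <= 3 * k], hence
   [dist x y <= 5 * k]; and no vertex is farther from [x] than [y]. *)
have [le_rx | lt_xr] := leqP (pi r) (pi x).
  exists x => //; rewrite dist_sym; apply: leq_trans (far_y v) _.
  have := far_x (p (pi y)); have := down r _ (piL y); have := up r x; have := up x y; lia.
have := far_x (p (pi v)); have := far_y (p (pi v)).
have := down r _ (piL v); have := down x _ (piL v); have := up r x; have := up x y.
have [lt_vx | le_xv] := ltnP (pi v) (pi x).
  by exists x => //; have := up v x; lia.
have [lt_yv | le_vy] := ltnP (pi y) (pi v).
  by exists y => //; have := up v y; lia.
have [|q qs le] := @crossing p L k pi x s (pi v) pP piL pik xs.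
  by rewrite xsy le_xv.
by exists q => //; have := dist_triangle (p (pi v)) v q; have := pik v; lia.
Qed.

End Approximation.

Lemma double_sweep_ecc r x y P : farthest r x -> farthest x y ->
  shortest_path_between x y P -> pecc P <= 5 * mesp_ecc G.
Proof.
move=> far_x far_y /shortest_path_betweenP [s [-> xs xsy _]].
apply: pecc_leP => v.
have [P0 [sP0 _] <-] := mesp_exists r cG.
have near := fun v => ecc_near v sP0; set k := pecc P0 in near *.
have /existsP [a /existsP [b /shortest_path_betweenP [s0 [eP0 as0 as0b sz0]]]] := sP0.
rewrite -as0b in sz0.
have pP i j := @dist_nth a a s0 i j as0 sz0; rewrite -eP0 in pP.
set p := nth a P0 in pP; set L := size s0 in pP.
have /fin_all_exists [pi piP] u : exists i, (i <= L) && (dist u (p i) <= k).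
  have [w wP le_uw] := near u; exists (index w P0).
  by rewrite /p nth_index // le_uw andbT -ltnS -[L.+1]/(size (a :: s0)) -eP0 index_mem.
have piL u : pi u <= L by case/andP: (piP u).
have pik u : dist u (p (pi u)) <= k by case/andP: (piP u).
(* If [y] projects before [x], the optimal path is read backwards, index [i] becoming [L - i]. *)
have [le_xy | /ltnW le_yx] := leqP (pi x) (pi y).
  exact: (@double_sweep_near k L r x y s far_x far_y xs xsy p pi).
apply: (@double_sweep_near k L r x y s far_x far_y xs xsy
  (fun i => p (L - i)) (fun u => L - pi u)) => [i j ij|u|u|]; try lia.
  by rewrite dist_sym pP; lia.
by rewrite subKn.
Qed.

End Metric.

(** * Total correctness with costs *)

Lemma regE s i v j :
  reg (set_reg s i v) j = if j == i then v else reg s j.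
Proof. by []. Qed.

Lemma reg_arr s a i v : reg (set_arr s a i v) = reg s.
Proof. by []. Qed.

Lemma arr_reg s i v : arr (set_reg s i v) = arr s.
Proof. by []. Qed.

Lemma arrE s a i v b j :
  arr (set_arr s a i v) b j = if (b == a) && (j == i) then v else arr s b j.
Proof. by rewrite /= /upd; case: eqP => [->|]. Qed.

(** Termination is part of the claim, and the postcondition also sees the running time. One run
    suffices, since [exec] is deterministic. *)
Definition wp c s (Q : nat -> store -> Prop) :=
  exists t s', exec c s t s' /\ Q t s'.

Lemma wp_skip s Q : Q 0 s -> wp Skip s Q.
Proof. by exists 0, s; split=> //; apply: ExecSkip. Qed.

Lemma wp_set s i e Q : Q 1 (set_reg s i (eval s e)) -> wp (Set_ i e) s Q.
Proof. by move=> q; do 2!eexists; split; [apply: ExecSet | exact: q]. Qed.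

Lemma wp_put s a i j Q :
  Q 1 (set_arr s a (reg s i) (reg s j)) -> wp (Put a i j) s Q.
Proof. by move=> q; do 2!eexists; split; [apply: ExecPut | exact: q]. Qed.

Lemma wp_seq c1 c2 s Q :
  wp c1 s (fun t1 s1 => wp c2 s1 (fun t2 => Q (t1 + t2))) -> wp (Seq c1 c2) s Q.
Proof.
move=> [t1 [s1 [e1 [t2 [s2 [e2 q]]]]]].
by exists (t1 + t2), s2; split=> //; apply: ExecSeq e1 e2.
Qed.

Lemma wp_if i j c1 c2 s Q :
  wp (if reg s i < reg s j then c1 else c2) s (fun t => Q t.+1) ->
  wp (IfLt i j c1 c2) s Q.
Proof.
move=> [t [s' [e q]]]; exists t.+1, s'; split=> //.
by move: e; case: ltnP => lt_ij e; [apply: ExecIfT | apply: ExecIfF].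
Qed.

Lemma wp_mono c s (Q Q' : nat -> store -> Prop) :
  (forall t s', Q t s' -> Q' t s') -> wp c s Q -> wp c s Q'.
Proof. by move=> QQ' [t [s' [e /QQ']]]; exists t, s'. Qed.

(* [I phi s] bundles the loop invariant with a potential [phi], which pays for
   the remaining iterations. *)
Lemma wp_while (I : nat -> store -> Prop) phi i j c s (Q : nat -> store -> Prop) :
  I phi s ->
  (forall phi s, I phi s -> reg s i < reg s j ->
     wp c s (fun t s' => exists2 phi', I phi' s' & t + phi' < phi)) ->
  (forall t phi' s', I phi' s' -> reg s' j <= reg s' i -> t + phi' <= phi + 1 ->
     Q t s') ->
  wp (WhileLt i j c) s Q.
Proof.
move=> Is step post.
suff [t [s' [phi' [e I' ge_ij le_t]]]] : exists t s' phi',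
    [/\ exec (WhileLt i j c) s t s', I phi' s', reg s' j <= reg s' i
      & t + phi' <= phi + 1].
  by exists t, s'; split; [| exact: post I' _ _].
(* The strict drop of the potential pays for the body and the successful test, and makes the
   induction well founded; the final [+ 1] is the failing test. *)
elim/ltn_ind: phi s Is {post Q} => phi IH s Is.
have [lt_ij | ge_ij] := ltnP (reg s i) (reg s j); last first.
  by exists 1, s, phi; split=> //; [apply: ExecWhileF | rewrite addnC].
have [t1 [s1 [e1 [phi1 I1 le1]]]] := step _ _ Is lt_ij.
have [|t2 [s2 [phi2 [e2 I2 ge2 le2]]]] := IH phi1 _ s1 I1; first by lia.
exists (t1 + t2).+1, s2, phi2; split=> //; first exact: ExecWhileT e1 e2.
by lia.
Qed.

(** * Queues of a breadth-first search *)

Definition degree (G : sgraph) (v : G) := #|[set w | adj v w]|.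

(** Handshake: an arc is determined by its edge and one Boolean, telling which of its ends comes
    first in the enumeration of the vertices. *)
Lemma sum_degree (G : sgraph) : \sum_(v : G) degree v <= 2 * #|edges G|.
Proof.
pose A := [set p : G * G | adj p.1 p.2].
have -> : \sum_(v : G) degree v = #|A|.
  rewrite -sum1_card (eq_bigl (fun p => true && adj p.1 p.2)); last by move=> p; rewrite inE.
  rewrite -(pair_big_dep xpredT (@adj G) (fun _ _ => 1)) /=.
  by apply: eq_bigr => v _; rewrite sum1_card /degree cardsE.
pose f (p : G * G) := ([set p.1; p.2], enum_rank p.1 < enum_rank p.2).
have inj_f : {in A &, injective f}.
  move=> [a b] [c d]; rewrite !inE /= => ab _ [] /setP eq_e.
  have := eq_e a; have := eq_e b; rewrite !inE !eqxx orbT /= => /esym bcd /esym acd.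
  have neq_ab : a != b by apply: contraTneq ab => ->; rewrite adj_irr.
  case/orP: acd => /eqP ea; case/orP: bcd => /eqP eb; move: neq_ab; subst => // neq.
  - by rewrite eqxx in neq.
  (* Reversed arcs with the same Boolean would have ends of equal rank. *)
  - by case: ltngtP => // /val_inj/enum_rank_inj cd; rewrite cd eqxx in neq.
  - by rewrite eqxx in neq.
rewrite -(card_in_imset inj_f) mulnC -card_bool -cardsT -cardsX.
apply/subset_leq_card/subsetP => _ /imsetP [[a b] + ->]; rewrite !inE /= andbT => ab.
by apply/imset2P; exists a b; rewrite ?inE.
Qed.

Section SearchQueue.
Variables (G : sgraph) (r : G).
Hypothesis cG : connected G.
Implicit Types (u v w : G) (qs : seq G).

(* [qs] lists the discovered vertices in order of discovery, and the neighbours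
   of its first [h] elements are all discovered. *)
Definition search_queue h qs :=
  [/\ uniq qs, r \in qs, pairwise (fun a b => dist r a <= dist r b) qs,
      forall i w, h <= i < size qs -> w \in qs -> dist r w <= (dist r (nth r qs i)).+1
    & forall i w, i < h -> i < size qs -> adj (nth r qs i) w -> w \in qs].

Lemma search_queue0 : search_queue 0 [:: r].
Proof.
split=> //; first exact: mem_head.
by case=> // w _; rewrite inE => /eqP ->; rewrite dist_refl.
Qed.

Lemma search_queue_sorted h qs i j : search_queue h qs -> i <= j < size qs ->
  dist r (nth r qs i) <= dist r (nth r qs j).
Proof.
case=> _ _ /(pairwiseP r) qsP _ _ /andP []; rewrite leq_eqVlt => /predU1P [-> //|].
by move=> lt_ij lt_j; apply: qsP => //; rewrite inE // (ltn_trans lt_ij).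
Qed.

(** Induction on the distance: the predecessor of [v] on a shortest path is queued and strictly
    closer than the vertex at [h], so by sortedness it lies in the processed prefix, whose
    neighbours are all queued. When the queue is exhausted the guard is void and every vertex is
    covered. *)
Lemma search_queue_mem h qs v : search_queue h qs ->
  (h < size qs -> dist r v <= dist r (nth r qs h)) -> v \in qs.
Proof.
move=> qsP; have [_ rqs _ _ closed] := qsP.
move: {2}(dist r v) (erefl (dist r v)) => n; elim: n v => [|n IHn] v dv le_v.
  by rewrite -(dist_eq0 cG dv).
have [w wv dw] := dist_pred cG dv.
have wqs : w \in qs by apply: IHn => // /le_v; rewrite dv dw; apply: ltnW.
have lt_i : index w qs < size qs by rewrite index_mem.
apply: (closed (index w qs)) => //; last by rewrite nth_index.
have [lt_h|] := ltnP h (size qs); last exact: leq_trans.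
rewrite ltnNge; apply/negP => le_hi.
have := search_queue_sorted qsP (i := h) (j := index w qs); rewrite nth_index // dw.
by have := le_v lt_h; rewrite dv; lia.
Qed.

(** By [search_queue_mem], an undiscovered vertex is farther than the processed one; adjacency
    leaves exactly one level, the largest that the queue may contain. *)
Lemma search_queue_discover h qs w : search_queue h qs -> h < size qs ->
  adj (nth r qs h) w -> w \notin qs ->
  dist r w = (dist r (nth r qs h)).+1 /\ search_queue h (rcons qs w).
Proof.
move=> qsP lt_h uw wqs; set u := nth r qs h in uw *.
have dw : dist r w = (dist r u).+1.
  apply/eqP; rewrite eqn_leq -(addn1 (dist r u)).
  rewrite (leq_trans (dist_triangle cG u r w)) ?leq_add2l ?dist_adj //=.
  by rewrite addn1 ltnNge; apply: contra wqs => le; apply: search_queue_mem qsP _.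
split=> //; have [Uqs rqs dqs near closed] := qsP.
have far v : v \in qs -> dist r v <= dist r w by rewrite dw; apply: near; rewrite leqnn.
split.
- by rewrite rcons_uniq wqs.
- by rewrite mem_rcons inE rqs orbT.
- by rewrite pairwise_rcons dqs andbT; apply/allP => v; apply: far.
- move=> i v; rewrite size_rcons nth_rcons mem_rcons inE => /andP [le_hi lt_i].
  case: (ltnP i (size qs)) => [lt_iqs|].
    case/predU1P => [->|vqs]; last by apply: near => //; rewrite le_hi.
    by rewrite dw ltnS; apply: search_queue_sorted qsP _; rewrite le_hi.
  move=> le_i; have -> : i == size qs by lia.
  by case/predU1P => [-> //|/far/leqW].
- move=> i v lt_ih _; rewrite nth_rcons (ltn_trans lt_ih lt_h) mem_rcons inE => /closed.
  by move=> -> //; rewrite ?orbT // (ltn_trans lt_ih).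
Qed.

Lemma search_queue_next h qs : search_queue h qs ->
  (forall w, adj (nth r qs h) w -> w \in qs) -> search_queue h.+1 qs.
Proof.
move=> [Uqs rqs dqs near closed] done_h; split=> // [i w /andP [lt_hi lt_i]|i w].
  by apply: near; rewrite (ltnW lt_hi).
by rewrite ltnS leq_eqVlt => /predU1P [-> _ /done_h //|]; apply: closed.
Qed.

Lemma search_queue_end h qs : search_queue h qs -> size qs <= h ->
  (forall v, v \in qs) /\ farthest r (nth r qs (size qs).-1).
Proof.
move=> qsP le_h; have all_qs v : v \in qs.
  by apply: search_queue_mem qsP _; rewrite ltnNge le_h.
split=> // v; rewrite -(nth_index r (all_qs v)).
have lt_v : index v qs < size qs by rewrite index_mem.
by apply: search_queue_sorted qsP _; lia.
Qed.

End SearchQueue.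

(** * The program *)

Definition storeE := (regE, reg_arr, arr_reg, arrE).

Ltac wp_run :=
  repeat (cbv beta; match goal with
  | |- wp (Seq _ _) _ _ => apply: wp_seq
  | |- wp (Set_ _ _) _ _ => apply: wp_set; cbn [eval]
  | |- wp (Put _ _ _) _ _ => apply: wp_put
  | |- wp Skip _ _ => apply: wp_skip
  end); cbv beta.

Section Search.
Variables (G : sgraph) (num : G -> 'I_#|G|) (off ad : nat -> nat).
Hypotheses (cG : connected G) (num_inj : injective num).
Hypothesis off_succ : forall v, off (num v).+1 = off (num v) + degree v.
Hypothesis adP : forall v,
  perm_eq [seq ad j | j <- iota (off (num v)) (degree v)]
          [seq (num w : nat) | w <- enum [set w | adj v w]].
Implicit Types (u v w : G) (s : store) (qs : seq G).

Lemma num_eq v w : (num v == num w :> nat) = (v == w).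
Proof. by rewrite val_eqE inj_eq. Qed.

Lemma ad_adj v j : j < degree v -> exists2 w, adj v w & ad (off (num v) + j) = num w.
Proof.
move=> lt_j; have : ad (off (num v) + j) \in [seq (num w : nat) | w <- enum [set w | adj v w]].
  by rewrite -(perm_mem (adP v)) map_f // mem_iota leq_addr ltn_add2l.
by case/mapP => w; rewrite mem_enum inE; exists w.
Qed.

Lemma adj_ad v w : adj v w -> exists2 j, j < degree v & ad (off (num v) + j) = num w.
Proof.
move=> vw; have : (num w : nat) \in [seq ad j | j <- iota (off (num v)) (degree v)].
  by rewrite (perm_mem (adP v)); apply: (map_f (fun w => num w : nat)); rewrite mem_enum inE.
case/mapP => j; rewrite mem_iota => /andP [le_j lt_j] ->.
by exists (j - off (num v)); rewrite ?subnKC // ltn_subLR.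
Qed.

Definition input_kept s :=
  [/\ reg s rN = #|G|, reg s rZERO = 0, reg s rONE = 1,
      forall i, arr s aOFF i = off i & forall i, arr s aADJ i = ad i].

(** * One breadth-first search on the machine *)

Section Source.
Variables (src : nat) (r : G).
(** The registers that [bfs] writes; the source register must survive them. *)
Definition scratch := [:: rHEAD; rTAIL; rU; rW; rI; rSTOP; rLU; rLW].
Hypothesis src_fresh : src \notin scratch.

Definition setup s := input_kept s /\ reg s src = num r.

Lemma reg_src s (i x : nat) : i \in scratch -> reg (set_reg s i x) src = reg s src.
Proof. by move=> iS; rewrite regE ifN //; apply: contraNneq src_fresh => ->. Qed.

Lemma setup_reg s (i x : nat) : i \in scratch -> setup s -> setup (set_reg s i x).
Proof.
move=> iS [[sN sZ sO1 sO sA] sr]; split; last first.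
  by rewrite reg_src.
by split=> //; rewrite regE ifN //; apply: contraTneq iS => <-.
Qed.

Lemma setup_arr s a i x : aADJ < a -> setup s -> setup (set_arr s a i x).
Proof.
move=> lt_a [[sN sZ sO1 sO sA] sr]; split=> //; split=> // j; rewrite arrE.
  by rewrite -sO; case: a lt_a.
by rewrite -sA; case: a lt_a => [|[|]].
Qed.

Definition is_parent s v u :=
  [/\ adj u v, dist r v = (dist r u).+1 & arr s aPARENT (num v) = num u].

Definition bfs_memory qs s :=
  [/\ reg s rTAIL = size qs,
      forall i, i < size qs -> arr s aQUEUE i = num (nth r qs i),
      forall v, arr s aLEVEL (num v) = if v \in qs then (dist r v).+1 else 0
    & forall v, v \in qs -> v <> r -> exists u, is_parent s v u].

Lemma memory_reg qs s (i x : nat) : i != rTAIL -> bfs_memory qs s -> bfs_memory qs (set_reg s i x).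
Proof.
by move=> ni [sT sQ sL sP]; split=> //; rewrite regE eq_sym (negPf ni).
Qed.

Lemma memory_discover qs s u w :
  bfs_memory qs s -> w \notin qs -> adj u w -> dist r w = (dist r u).+1 ->
  reg s rW = num w -> reg s rU = num u -> reg s rLU = (dist r u).+2 ->
  let s1 := set_arr s aLEVEL (reg s rW) (reg s rLU) in
  let s2 := set_arr s1 aPARENT (reg s rW) (reg s rU) in
  let s3 := set_arr s2 aQUEUE (reg s rTAIL) (reg s rW) in
  bfs_memory (rcons qs w) (set_reg s3 rTAIL (reg s rTAIL).+1).
Proof.
move=> [sT sQ sL sP] wqs uw dw sW sU sLU s1 s2 s3; rewrite /s3 /s2 /s1 sT sW sU sLU.
split.
- by rewrite size_rcons.
- move=> i; rewrite size_rcons ltnS !storeE /= nth_rcons => le_i.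
  case: eqP => [->|ne_i]; first by rewrite ltnn.
  by have lt_i : i < size qs by [lia]; rewrite lt_i sQ.
- move=> v; rewrite !storeE /= num_eq mem_rcons inE.
  by case: eqP => [->|//]; rewrite dw.
- move=> v; rewrite mem_rcons inE /is_parent !storeE /= num_eq.
  case: eqP => [-> _ _|_ /= vqs nvr]; first by exists u.
  by have [u' [? ? ?]] := sP v vqs nvr; exists u'.
Qed.

Definition bfs_tree s :=
  [/\ setup s, forall v, arr s aLEVEL (num v) = (dist r v).+1
    & forall v, v <> r -> exists u, is_parent s v u].

(* The inner loop costs at most 9 per neighbour, the rest of the outer one 9. *)
Definition cost v := 9 * (degree v).+1.

(** The queue [qs] grows during the scan, while [p] and [u] record that its processed prefix and
    current vertex do not change; [j] neighbours have been examined. *)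
Definition scan_inv h p u phi s :=
  exists qs j,
  [/\ setup s, bfs_memory qs s & search_queue r h qs] /\
  [/\ h < size qs, nth r qs h = u, take h qs = p
    & forall i w, i < j -> ad (off (num u) + i) = num w -> w \in qs] /\
  [/\ reg s rU = num u, reg s rHEAD = h.+1, reg s rLU = (dist r u).+2,
      reg s rI = off (num u) + j & reg s rSTOP = off (num u) + degree u] /\
  j <= degree u /\ phi = 9 * (degree u - j).

(** The potential charges every unprocessed vertex, discovered or not, so a discovery leaves it
    unchanged. [rU] keeps the last processed vertex, which the search finally returns. *)
Definition search_inv phi s :=
  exists qs h,
  [/\ setup s, bfs_memory qs s & search_queue r h qs] /\
  [/\ h <= size qs, reg s rHEAD = h, 0 < h -> reg s rU = num (nth r qs h.-1)
    & phi = \sum_(v | v \notin take h qs) cost v].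

Definition clear_inv phi s :=
  exists i, [/\ setup s, reg s rI = i, forall j, j < i -> arr s aLEVEL j = 0,
                i <= #|G| & phi = 3 * (#|G| - i)].

Ltac keep_setup := by repeat first [apply: setup_reg => // | apply: setup_arr => //].

Lemma scan_step h p u phi s : scan_inv h p u phi s -> reg s rI < reg s rSTOP ->
  wp (rW ::= Get aADJ rI ;;
      rLW ::= Get aLEVEL rW ;;
      IfLt rZERO rLW Skip (
        Put aLEVEL rW rLU ;;
        Put aPARENT rW rU ;;
        Put aQUEUE rTAIL rW ;;
        rTAIL ::= Succ rTAIL) ;;
      rI ::= Succ rI)%cmd s
    (fun t s' => exists2 phi', scan_inv h p u phi' s' & t + phi' < phi).
Proof.
move=> [qs [j [[ss sm sq] [[lt_h eu ep done_j] [[sU sH sLU sI sS] [le_j ->]]]]]].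
rewrite sI sS ltn_add2l => lt_j.
have [[sN sZ sO1 sO sA] _] := ss; have [_ _ sL _] := sm.
have [w uw adw] := ad_adj lt_j.
wp_run; apply: wp_if; rewrite !storeE /= sZ sI sA adw sL.
(* Serves both branches, with [qs' = qs] and with [qs' = rcons qs w]. *)
have done_w qs' : {subset qs <= qs'} -> w \in qs' ->
    forall i v, i < j.+1 -> ad (off (num u) + i) = num v -> v \in qs'.
  move=> sub wqs' i v; rewrite ltnS leq_eqVlt => /predU1P [->|].
    by rewrite adw => /val_inj/num_inj <-.
  by move=> lt_i /(done_j _ _ lt_i)/sub.
case: ifP => /=.
  case: ifP => // wqs _; wp_run; exists (9 * (degree u - j.+1)); last by lia.
  exists qs, j.+1; split; first by split=> //; keep_setup.
  split; first by split=> //; apply: done_w.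
  by split=> //; rewrite !storeE /= sI addnS; split.
case: ifP => // /negbT wqs _.
have uw' : adj (nth r qs h) w by rewrite eu.
have [dw sq'] := search_queue_discover cG sq lt_h uw' wqs.
rewrite eu in dw.
wp_run; exists (9 * (degree u - j.+1)); last by lia.
exists (rcons qs w), j.+1; split.
  split=> //; first keep_setup.
  by apply: memory_reg => //; apply: (memory_discover (u := u)) => //.
split; first split=> //; rewrite ?size_rcons ?nth_rcons ?lt_h ?(leqW lt_h) //.
    by rewrite -cats1 takel_cat // ltnW.
  apply: done_w; last by rewrite mem_rcons mem_head.
  by move=> v vqs; rewrite mem_rcons inE vqs orbT.
by split=> //; rewrite !storeE /= sI addnS; split.
Qed.

Lemma memory_init s :
  reg s src = num r -> reg s rTAIL = 1 -> reg s rHEAD = 0 -> reg s rONE = 1 ->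
  (forall v, arr s aLEVEL (num v) = 0) ->
  let s1 := set_arr s aQUEUE (reg s rHEAD) (reg s src) in
  let s2 := set_arr s1 aLEVEL (reg s src) (reg s rONE) in
  bfs_memory [:: r] (set_arr s2 aPARENT (reg s src) (reg s src)).
Proof.
move=> sr sT sH sO sL s1 s2; rewrite /s2 /s1 sr sH sO; split=> //.
- by case=> // _; rewrite !storeE.
- by move=> v; rewrite !storeE /= num_eq inE; case: eqP => // ->; rewrite dist_refl.
- by move=> v; rewrite inE => /eqP.
Qed.

(** Clearing costs 3 per cell, two assignments and a test; the 8 counts the six assignments outside
    the loops and their two failing tests. *)
Lemma bfs_wp s : setup s ->
  wp (bfs src) s (fun t s' => exists x,
    [/\ bfs_tree s', farthest r x, reg s' rU = num x
      & t <= 3 * #|G| + \sum_v cost v + 8]).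
Proof.
move=> ss; rewrite /bfs; wp_run.
apply: (wp_while (I := clear_inv) (phi := 3 * #|G|)).
- by exists 0; split; rewrite ?subn0 //; keep_setup.
- move=> phi s1 [i [ss1 sI cl le_i ->]]; have [[sN sZ _ _ _] _] := ss1.
  rewrite sI sN => lt_i; wp_run; exists (3 * (#|G| - i.+1)); last by lia.
  exists i.+1; split=> //; [by keep_setup | by rewrite !storeE /= sI|].
  move=> j; rewrite !storeE /= sI sZ ltnS leq_eqVlt; case: eqP => //= _.
  exact: cl.
move=> t phi s1 [i [ss1 sI cl le_i phi_i]] le_n le_t; have [[sN sZ sO _ _] sr] := ss1.
rewrite sI sN in le_n; wp_run.
apply: (wp_while (I := search_inv) (phi := \sum_v cost v)).
- exists [:: r], 0; split; last by split.
  split; [by keep_setup | | exact: search_queue0].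
  apply: memory_init; rewrite ?reg_src // => v.
  by rewrite !arr_reg cl // (leq_trans _ le_n).
- move=> phi' s2 [qs [h [[ss2 sm sq] [le_h sH sU ->]]]].
  have [sT sQ sL _] := sm; rewrite sH sT => lt_h.
  have [[_ _ _ sOff _] _] := ss2; set u := nth r qs h.
  wp_run.
  apply: (wp_while (I := scan_inv h (take h qs) u) (phi := 9 * degree u)).
  + exists qs, 0; split; first by split=> //; keep_setup.
    split; first by split.
    rewrite !storeE /= sH !sQ // sL mem_nth // !sOff off_succ addn0 subn0; split=> //.
  + exact: scan_step.
  move=> t2 phi2 s3 [qs' [j [[ss3 sm3 sq3] [[lt_h3 eu ep done_j]]]]].
  move=> [[sU3 sH3 _ sI3 sS3] [le_j _]]; rewrite sI3 sS3 leq_add2l => ge_j le_t2.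
  have sq4 : search_queue r h.+1 qs'.
    apply: search_queue_next sq3 _ => w; rewrite eu => /adj_ad [l lt_l].
    by apply: done_j; apply: leq_trans ge_j.
  have eq_take : take h.+1 qs' = rcons (take h qs) u by rewrite (take_nth r) // ep eu.
  (* The queue has no repetition, so the cost of [u] is still in the potential and can pay for this
     iteration. *)
  have u_new : u \notin take h qs.
    have [Uqs _ _ _ _] := sq3; have := take_uniq h.+1 Uqs.
    by rewrite eq_take rcons_uniq => /andP [].
  exists (\sum_(v | v \notin take h.+1 qs') cost v).
    exists qs', h.+1; split=> //; split=> // _.
    by rewrite /= sU3 eu.
  rewrite (bigD1 u u_new) /= eq_take.
  rewrite (eq_bigl (fun v => (v \notin take h qs) && (v != u))); last first.
    by move=> v; rewrite mem_rcons inE negb_or andbC.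
  by rewrite ltn_add2r /cost; lia.
move=> t3 phi3 s3 [qs [h [[ss3 sm sq] [le_h sH sU _]]]].
have [sT _ sL sP] := sm; rewrite sH sT => ge_h le_t3.
(* The loop exits with [h = size qs], so [rU] holds the last vertex of the sorted queue. *)
have [all_qs far] := search_queue_end cG sq ge_h.
have eh : h = size qs by lia.
have qs_gt0 : 0 < size qs by have := all_qs r; case: (qs).
exists (nth r qs (size qs).-1); split=> //.
- split=> // v; first by rewrite sL all_qs.
  exact: sP.
- by rewrite sU eh.
by lia.
Qed.

End Source.

(** * Following the parents back to the source *)

Section Trace.
Variables x y : G.
Let next u v := adj u v && (dist x v == (dist x u).+1).

(** [S] is the suffix already written and [u] the vertex about to be written in front of it. Once
    [x] is written, [rU] receives the parent cell of [x], on which nothing is assumed; hence the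
    separate clause for [i = 0]. An iteration costs 4, three assignments and a test. *)
Definition trace_inv phi s :=
  exists i S,
  [/\ reg s rI = i, reg s rLEN = (dist x y).+1, reg s rZERO = 0,
      forall v, v <> x -> exists u, is_parent x s v u & phi = 4 * i] /\
  [/\ size S + i = (dist x y).+1,
      [seq arr s aPATH j | j <- iota i (size S)] = [seq (num v : nat) | v <- S],
      0 < i -> exists u,
        [/\ reg s rU = num u, dist x u = i.-1, path next u S & last u S = y]
    & i = 0 -> exists S', [/\ S = x :: S', path next x S' & last x S' = y]].

(** Distances from [x] increase strictly along [next], which excludes repetitions. *)
Lemma next_shortest S : path next x S -> last x S = y -> size S = dist x y ->
  shortest_path_between x y (x :: S).
Proof.
move=> xS ey sz; have Ux : uniq (x :: S).
  apply: (sorted_uniq (leT := fun u v => dist x u < dist x v)) => [v u w||].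
  - exact: ltn_trans.
  - by move=> u; rewrite ltnn.
  by apply: sub_path xS => u v /andP [_ /eqP ->].
have xS' : path (@adj G) x S by apply: sub_path xS => u v /andP [].
by rewrite /shortest_path_between /path_between /plength /is_path xS' Ux /= ey sz !eqxx.
Qed.

Lemma trace_step phi s : trace_inv phi s -> reg s rZERO < reg s rI ->
  wp (rI ::= Pred rI ;; Put aPATH rI rU ;; rU ::= Get aPARENT rU)%cmd s
    (fun t s' => exists2 phi', trace_inv phi' s' & t + phi' < phi).
Proof.
move=> [[|i] [S [[sI sLEN sZ sP ->] [sz eS posS _]]]]; rewrite sI sZ // => _.
have [u [sU du uS eyS]] := posS isT; rewrite /= in du.
wp_run; exists (4 * i); last by lia.
exists i, (u :: S); split.
  by split; rewrite ?storeE /= ?sI.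
split; first by rewrite -addSnnS in sz.
- rewrite -[iota i _]/(i :: iota i.+1 (size S)) !map_cons -eS; congr cons.
    by rewrite !storeE /= sI eqxx sU.
  apply/eq_in_map => j.
  by rewrite mem_iota !storeE /= => /andP [lt_ij _]; rewrite sI ifN // neq_ltn lt_ij orbT.
(* As [u] is at distance [i > 0] from [x], it differs from [x] and has a parent one level closer. *)
- move=> i_gt0; have [|v [vu dv pv]] := sP u.
    by move=> eu; rewrite eu dist_refl // in du; rewrite -du in i_gt0.
  exists v; split=> //; last by rewrite /= /next vu dv eqxx.
    by rewrite !storeE /= sU.
  by rewrite -du dv.
- by move=> i0; rewrite i0 in du; exists S; rewrite (dist_eq0 cG du).
Qed.

End Trace.

Lemma double_bfs_wp s r : input_kept (set_reg (set_reg s rZERO 0) rONE 1) ->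
  reg s rR = num r ->
  wp double_bfs s (fun t s' => t <= 100 * (#|G| + #|edges G|) /\
    exists x y P, [/\ farthest r x, farthest x y, shortest_path_between x y P
      & outputs num s' P]).
Proof.
move=> s_in sr; rewrite /double_bfs.
apply: wp_seq; apply: wp_set; apply: wp_seq; apply: wp_set; apply: wp_seq.
apply: wp_mono (@bfs_wp rR r isT _ _); last by split.
move=> t1 s1 [x [[[s1_in _] _ _] far_x s1U le_t1]].
apply: wp_seq; apply: wp_set; apply: wp_seq.
apply: wp_mono (@bfs_wp rX x isT _ _); last by split.
move=> t2 s2 [y [[[s2_in _] s2L s2P] far_y s2U le_t2]].
have [_ s2Z _ _ _] := s2_in.
have le_cost : \sum_v cost v <= 9 * (2 * #|edges G| + #|G|).
  rewrite -big_distrr /= leq_mul2l /=.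
  under eq_bigr => v _ do rewrite -addn1.
  by rewrite big_split /= sum1_card leq_add2r sum_degree.
have lt_xy := dist_lt x y cG.
do 4!(apply: wp_seq; apply: wp_set).
apply: (wp_while (I := trace_inv x y) (phi := 4 * (dist x y).+1)).
- exists (dist x y).+1, [::]; split.
    by split; rewrite ?storeE //= s2U s2L.
  by split=> // _; exists y; rewrite !storeE /= s2U.
- exact: trace_step.
move=> t phi s' [i [S [[sI sLEN sZ _ _] [sz eS _ S0]]]]; rewrite sI sZ leqn0 => /eqP i0 le_t.
(* The searches cost at most [24 * #|G| + 36 * #|edges G| + 16] together, the trace [4 * #|G| + 1],
   and seven assignments remain; since [#|G|] is positive, 100 absorbs the constants. *)
split; first by lia.
have [S' [eS' xS' ey]] := S0 i0.
exists x, y, S; split=> //.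
  by rewrite eS'; apply: next_shortest => //; move: sz; rewrite eS' i0 addn0 => -[].
by rewrite /outputs sLEN -eS -sz i0 addn0.
Qed.

End Search.

(** The initial contents of the two input arrays serve as [off] and [ad]. *)
Lemma double_bfs_correct (G : sgraph) num (r : G) s : connected G -> encodes num r s ->
  wp double_bfs s (fun t s' => t <= 100 * (#|G| + #|edges G|) /\
    exists x y P, [/\ farthest r x, farthest x y, shortest_path_between x y P
      & outputs num s' P]).
Proof.
move=> cG [num_inj sN sR _ adj_s].
apply: (@double_bfs_wp G num (arr s aOFF) (arr s aADJ)) => // v; by case: (adj_s v).
Qed.

Theorem theorem2 :
  (forall (G : sgraph) (r x y : G) (P : seq G),
      connected G -> farthest r x -> farthest x y ->
      shortest_path_between x y P ->
      pecc P <= 5 * mesp_ecc G) /\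
  always_outputs double_bfs
    (fun G r P => exists x y : G,
       [/\ farthest r x, farthest x y & shortest_path_between x y P]) /\
  runs_in_linear_time double_bfs /\
  mesp_approximation 5 double_bfs.
Proof.
have ecc5 (G : sgraph) (r x y : G) P : connected G -> farthest r x -> farthest x y ->
    shortest_path_between x y P -> pecc P <= 5 * mesp_ecc G.
  by move=> cG; apply: double_sweep_ecc.
have out : always_outputs double_bfs (fun G r P => exists x y : G,
    [/\ farthest r x, farthest x y & shortest_path_between x y P]).
  move=> G num r s t s' cG enc e.
  have [t1 [s1 [e1 [_ [x [y [P [fx fy sP oP]]]]]]]] := double_bfs_correct cG enc.
  (* Determinism carries the result from the run provided by [wp] to the given one. *)
  have [_ es] := exec_det e e1; rewrite es.
  by exists P => //; exists x, y.
split=> //; split=> //; split.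
  exists 100 => G num r s cG /(double_bfs_correct cG) [t [s' [e [le_t _]]]].
  by exists t, s'.
move=> G num r s t s' cG enc /(out _ _ _ _ _ _ cG enc) [P oP [x [y [fx fy sP]]]].
exists P => //; split; last exact: ecc5 sP.
by apply/existsP; exists x; apply/existsP; exists y.
Qed.
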